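(* All mixing-type sub-rooted cluster algebras of a rooted cluster algebra of finite type (respectively, of finite mutation type) are of finite type (respectively, of finite mutation type).
   Context: **Seeds and cluster algebras.** A seed $\Sigma=(X,X_{fr},\widetilde B)$ consists of disjoint finite sets $X=\{x_1,\dots,x_n\}$ (the cluster; its elements are exchangeable variables; $X=\emptyset$ is allowed) and $X_{fr}=\{x_{n+1},\dots,x_{n+m}\}$ (frozen variables) such that the extended cluster $\widetilde X=X\cup X_{fr}$ is algebraically independent over $\mathbb Q$ and generates the field $\mathbb F(\Sigma)=\mathbb Q(\widetilde X)$, together with an integer matrix $\widetilde B=(b_{xy})_{x\in X,y\in\widetilde X}$ whose principal part $B=(b_{xy})_{x,y\in X}$ (the exchange matrix) is totally sign-skew-symmetric: every matrix obtained from it by finitely many mutations is sign-skew-symmetric (for all $x,y$, either $b_{xy}=b_{yx}=0$ or $b_{xy}b_{yx}<0$). For $x\in X$ the mutation $\mu_x(\Sigma)$ replaces $x$ by $\mu_x(x)=x^{-1}\bigl(\prod_{b_{xt}>0}t^{b_{xt}}+\prod_{b_{xt}<0}t^{-b_{xt}}\bigr)$ ($t\in\widetilde X$), fixes the other variables ($\mu_x(y)=y$ for $y\ne x$), and replaces $\widetilde B$ by the matrix with entries $-b_{yz}$ if $y=x$ or $z=x$, and $b_{yz}+\frac{|b_{yx}|b_{xz}+b_{yx}|b_{xz}|}{2}$ otherwise (relabelling $x$ as $\mu_x(x)$). The rooted cluster algebra $\mathcal A(\Sigma)$ is the $\mathbb Z[X_{fr}]$-subalgebra of $\mathbb F(\Sigma)$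 generated by all cluster variables in all seeds obtained from $\Sigma$ by iterated mutations, together with its initial seed $\Sigma$. **Types.** $\mathcal A(\Sigma)$ is of finite type if it has finitely many cluster variables, and of finite mutation type if the set of exchange matrices of all seeds mutation equivalent to $\Sigma$ is finite up to simultaneous permutation of rows and columns. **Mixing-type sub-rooted cluster algebras.** For $I_0\subseteq X$, $I_1\subseteq\widetilde X$, $I_0\cap I_1=\emptyset$, $\Sigma_{I_0,I_1}=(X\setminus(I_0\cup I_1),(X_{fr}\cup I_0)\setminus I_1,\widetilde B')$, with $\widetilde B'$ the restriction of $\widetilde B$ to rows $X\setminus(I_0\cup I_1)$ and columns $\widetilde X\setminus I_1$. A mixing-type sub-rooted cluster algebra of $\mathcal A(\Sigma)$ is a rooted cluster algebra $\mathcal A(\Sigma')$ isomorphic to some $\mathcal A(\Sigma_{I_0,I_1})$ by a rooted cluster isomorphism. Here a rooted cluster morphism $f:\mathcal A(\Sigma)\to\mathcal A(\Sigma')$ is a unital ring homomorphism with $f(\widetilde X)\subseteq\widetilde X'\sqcup\mathbb Z$, $f(X)\subseteq X'\sqcup\mathbb Z$ and $f(\mu_{y_s}\cdots\mu_{y_1}(y))=\mu_{f(y_s)}\cdots\mu_{f(y_1)}(f(y))$ for all $y\in\widetilde X$ and all sequences $(y_1,\dots,y_s)$ such that each $y_i$ is exchangeable in $\mu_{y_{i-1}}\cdots\mu_{y_1}(\Sigma)$ and each $f(y_i)$ is exchangeable in $\mu_{f(y_{i-1})}\cdots\mu_{f(y_1)}(\Sigma')$ (mutations fix integers); it is an isomorphism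 if it is bijective. *)

(* Defs.v *)
From HB Require Import structures.
From mathcomp Require Import all_boot all_order all_fingroup all_algebra.
From mathcomp Require Import mpoly.
From mathcomp Require Import boolp classical_sets cardinality.

Set Implicit Arguments.
Unset Strict Implicit.
Unset Printing Implicit Defensive.

Import GRing.Theory Num.Theory.

Local Open Scope ring_scope.

(* Matrices are functions on finite label types. The rows of a rectangular    *)
(* matrix are identified with some of its columns through [inc]: it is [inl]  *)
(* for extended exchange matrices and [id] for square ones.                   *)
(* The division by 2 is exact.                                                *)
Definition mx_mutate (R C : eqType) (inc : R -> C) (x : R)
    (b : R -> C -> int) : R -> C -> int :=
  fun y z =>
    if (y == x) || (z == inc x) then - b y z
    else b y z + ((`|b y (inc x)| * b x z + b y (inc x) * `|b x z|) %/ 2)%Z.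

Definition sign_skew_symmetric (E : Type) (b : E -> E -> int) : Prop :=
  forall x y, (b x y = 0 /\ b y x = 0) \/ b x y * b y x < 0.

Definition totally_sign_skew_symmetric (E : eqType) (b : E -> E -> int) :
    Prop :=
  forall s : seq E,
    sign_skew_symmetric (foldl (fun c x => mx_mutate id x c) b s).

Definition algebraically_independent (K : fieldType) (T : finType)
    (v : T -> K) : Prop :=
  forall p : {mpoly rat[#|T|]},
    mmap (@ratr K) (fun i => v (enum_val i)) p = 0 -> p = 0.

(* The exchangeable variables are labelled by E and the frozen ones by F, so  *)
(* that mutation keeps the label of the mutated variable. All variables live  *)
(* in an ambient field K; the field of the seed is the subfield of K          *)
(* generated by the extended cluster, which may be smaller than K: this       *)
(* happens for sub-seeds obtained by deleting variables.                      *)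
Record seed (K : fieldType) (E F : finType) := Seed {
  var : E + F -> K;
  bmat : E -> E + F -> int }.

Section Seeds.
Variables (K : fieldType) (E F : finType).
Implicit Types (S : seed K E F) (x : E) (t : E + F) (y z : K).

Definition exchange_matrix S : E -> E -> int := fun x x' => bmat S x (inl x').

Definition is_seed S : Prop :=
  [/\ [pchar K] =i pred0,
      algebraically_independent (var S)
    & totally_sign_skew_symmetric (exchange_matrix S)].

Definition new_var S x : K :=
  (var S (inl x))^-1 *
  (\prod_(t | 0 < bmat S x t) var S t ^ bmat S x t +
   \prod_(t | bmat S x t < 0) var S t ^ (- bmat S x t)).

Definition mutate S x : seed K E F :=
  Seed (fun t => if t == inl x then new_var S x else var S t)
       (mx_mutate inl x (bmat S)).

Definition mutations S (s : seq E) : seed K E F := foldl mutate S s.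

Definition cluster_variable S z : Prop :=
  exists s x, z = var (mutations S s) (inl x).

(* A Z[X_fr]-subalgebra is a subring containing the frozen variables. *)
Inductive in_rca S : K -> Prop :=
| in_rca1 : in_rca S 1
| in_rca_frozen (j : F) : in_rca S (var S (inr j))
| in_rca_cluster z : cluster_variable S z -> in_rca S z
| in_rcaB y z : in_rca S y -> in_rca S z -> in_rca S (y - z)
| in_rcaM y z : in_rca S y -> in_rca S z -> in_rca S (y * z).

Definition rca_pred S : {pred K} := fun z => `[< in_rca S z >].

Lemma rca_predE S z : (z \in rca_pred S) = `[< in_rca S z >].
Proof. by []. Qed.

Lemma rca_subring_closed S : subring_closed (rca_pred S).
Proof.
split; first by rewrite rca_predE; apply/asboolP; constructor.
- move=> y z; rewrite !rca_predE => /asboolP hy /asboolP hz.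
  by apply/asboolP; constructor.
- move=> y z; rewrite !rca_predE => /asboolP hy /asboolP hz.
  by apply/asboolP; constructor.
Qed.

HB.instance Definition _ S :=
  GRing.isSubringClosed.Build K (rca_pred S) (rca_subring_closed S).

Record rca S := RCA { rca_val : K; rca_valP : rca_val \in rca_pred S }.

HB.instance Definition _ S := [isSub for @rca_val S].
HB.instance Definition _ S := [Choice of rca S by <:].
HB.instance Definition _ S := [SubChoice_isSubComNzRing of rca S by <:].

(* Mutations in directions given by elements of K. Mutating in a direction    *)
(* which is not exchangeable does nothing; this case is excluded whenever     *)
(* these operations are used.                                                 *)

Definition exchangeable S y : Prop := exists x, var S (inl x) = y.

Definition seed_mut S y : seed K E F :=
  if [pick x | var S (inl x) == y] is Some x then mutate S x else S.

Definition elt_mut S y z : K :=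
  if [pick x | var S (inl x) == y] is Some x
  then if z == y then new_var S x else z
  else z.

Fixpoint admissible S (ys : seq K) : Prop :=
  if ys is y :: ys' then exchangeable S y /\ admissible (seed_mut S y) ys'
  else True.

(* elt_muts S [:: y1; ...; ys] z is mu_ys ... mu_y1 (z), where mu_yi is the   *)
(* mutation of the seed mu_y(i-1) ... mu_y1 (S).                              *)
Fixpoint elt_muts S (ys : seq K) z : K :=
  if ys is y :: ys' then elt_muts (seed_mut S y) ys' (elt_mut S y z) else z.

Lemma elt_muts_var S ys t :
  exists s u, elt_muts S ys (var S t) = var (mutations S s) u.
Proof.
elim: ys S t => [|y ys IH] S t /=; first by exists [::], t.
rewrite /elt_mut /seed_mut; case: pickP => [x /eqP xy|_]; last exact: IH.
have [u ->] : exists u,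
    (if var S t == y then new_var S x else var S t) = var (mutate S x) u.
  case: eqP => [_|ty]; first by exists (inl x); rewrite /= eqxx.
  by exists t => /=; case: eqP => // tx; case: ty; rewrite tx.
by have [s [v ->]] := IH (mutate S x) u; exists (x :: s), v.
Qed.

Lemma var_mutations_frozen S s (j : F) :
  var (mutations S s) (inr j) = var S (inr j).
Proof. by elim: s S => //= x s IH S; rewrite IH. Qed.

Lemma elt_muts_rca S ys t : elt_muts S ys (var S t) \in rca_pred S.
Proof.
have [s [[x|j] ->]] := elt_muts_var S ys t; rewrite rca_predE; apply/asboolP.
  by apply: in_rca_cluster; exists s, x.
by rewrite var_mutations_frozen; apply: in_rca_frozen.
Qed.

Definition rca_muts S ys t : rca S := RCA (elt_muts_rca S ys t).

Definition rca_var S t : rca S := rca_muts S [::] t.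

Definition finite_type S : Prop := finite_set [set z | cluster_variable S z].

Definition perm_class (b : E -> E -> int) : set (E -> E -> int) :=
  [set c | exists s : {perm E}, c = fun x x' => b (s x) (s x')].

Definition finite_mutation_type S : Prop :=
  finite_set
    [set perm_class (exchange_matrix (mutations S s)) | s in [set: seq E]].

(* The labels of the sub-seed: the exchangeable ones are those of             *)
(* X \ (I0 u I1), the frozen ones those of (X_fr u I0) \ I1.                  *)
Definition sub_ex (I0 : {set E}) (I1 : {set E + F}) : finType :=
  {x : E | (x \notin I0) && (inl x \notin I1)}.

Definition sub_fr (I0 : {set E}) (I1 : {set E + F}) : finType :=
  {t : E + F |
    (if t is inl x then x \in I0 else true) && (t \notin I1)}.

Definition sub_label I0 I1 (u : sub_ex I0 I1 + sub_fr I0 I1) : E + F :=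
  match u with inl x => inl (val x) | inr j => val j end.

Definition sub_seed S I0 I1 : seed K (sub_ex I0 I1) (sub_fr I0 I1) :=
  Seed (fun u => var S (sub_label u))
       (fun i u => bmat S (val i) (sub_label u)).

End Seeds.

Section Morphisms.
Variables (K K' : fieldType) (E F E' F' : finType).

Definition rooted_cluster_morphism (S : seed K E F) (S' : seed K' E' F')
    (f : {rmorphism rca S -> rca S'}) : Prop :=
  [/\ forall t : E + F,
        (exists t', f (rca_var S t) = rca_var S' t') \/
        (exists k : int, f (rca_var S t) = k%:~R),
      forall x : E,
        (exists x', f (rca_var S (inl x)) = rca_var S' (inl x')) \/
        (exists k : int, f (rca_var S (inl x)) = k%:~R)
    & forall (t : E + F) (ys : seq (rca S)),
        let zs := [seq val y | y <- ys] in
        let zs' := [seq val (f y) | y <- ys] in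
        admissible S zs -> admissible S' zs' ->
        val (f (rca_muts S zs t)) = elt_muts S' zs' (val (f (rca_var S t)))].

Definition rooted_cluster_isomorphism (S : seed K E F) (S' : seed K' E' F')
    (f : {rmorphism rca S -> rca S'}) : Prop :=
  rooted_cluster_morphism f /\ bijective f.

End Morphisms.

(* A(S') is a mixing-type sub-rooted cluster algebra of A(S). *)
Definition mixing_sub_rca (K K' : fieldType) (E F E' F' : finType)
    (S' : seed K' E' F') (S : seed K E F) : Prop :=
  exists (I0 : {set E}) (I1 : {set E + F}),
    (forall x, x \in I0 -> inl x \notin I1) /\
    exists f : {rmorphism rca S' -> rca (sub_seed S I0 I1)},
      rooted_cluster_isomorphism f.

(* Main.v *)
From HB Require Import structures.
Require Import Defs.
From mathcomp Require Import all_boot all_order all_fingroup all_algebra.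
From mathcomp Require Import mpoly ring.
From mathcomp Require Import boolp classical_sets cardinality.

(* Cluster variables are subtraction-free rational expressions in the initial *)
(* extended cluster. Such expressions take nonzero values wherever the        *)
(* variables are set to positive rationals or to 1, so an identity between    *)
(* them in algebraically independent variables survives these                 *)
(* specialisations.                                                           *)
(* Deleting the variables in I1 amounts to setting them to 1, and freezing    *)
(* those in I0 merely forbids some mutations. Hence the cluster variables of  *)
(* a sub-seed are specialisations of cluster variables of S, and its exchange *)
(* matrices are submatrices of exchange matrices of S.                        *)
(* An injective rooted cluster morphism sends initial variables to distinct   *)
(* initial variables, hence, along every mutation sequence, cluster variables *)
(* to cluster variables; this settles finite type. It also carries exchange   *)
(* relations to exchange relations; setting one variable to 2 and the others  *)
(* to 1 in them gives 2 ^ |b| + 1 = 2 ^ |b'| + 1, so the morphism preserves   *)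
(* the absolute values of the entries of the exchange matrices, and finite    *)
(* mutation type just means that all these entries are bounded.               *)

Set Implicit Arguments.
Unset Strict Implicit.
Unset Printing Implicit Defensive.

Import Order.TTheory GRing.Theory Num.Theory.
Local Open Scope ring_scope.

(** Algebraic independence enters through [sf_free]: an identity between subtraction-free
    expressions in the variables persists at every positive rational point. Mutated seeds and
    sub-seeds inherit this ([sf_free_mutations], [sf_free_sub_seed]), and it separates the variables
    from each other and from the integers ([sf_free_inj], [sf_free_not_int]). The passage from [S]
    to a sub-seed is [finite_type_sub_seed], where [algebraically_independent_determines] makes the
    specialisation to 1 well defined, and [bounded_exchange_matrices_sub_seed]. The passage along
    the isomorphism rests on [rooted_cluster_mutations], which matches the two algebras variable by
    variable along every mutation sequence; finite type follows in [finite_type_rooted_cluster]. An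
    exchange relation does not see the sign of a row of the matrix, so only absolute values of
    entries can be compared ([abs_exchange_matrix_rooted_cluster]). By
    [finite_mutation_type_bounded] this is enough. *)

(** * The embedding of the rationals into a field of characteristic 0 *)

Section RatrCharZero.
Variables (K : fieldType) (charK : [pchar K] =i pred0).

Lemma natr_neq0_char0 n : (n.+1%:R : K) != 0.
Proof. by move/pcharf0P: charK => ->. Qed.

Lemma intr_neq0_char0 (m : int) : m != 0 -> (m%:~R : K) != 0.
Proof.
case: m => [[|n]|n] // _; first exact: natr_neq0_char0.
by rewrite NegzE mulrNz oppr_eq0; apply: natr_neq0_char0.
Qed.

(** [ratr] is defined by the reduced fraction; allowing any fraction lets sums and products be
    computed over a common denominator. *)
Lemma ratr_frac_char0 (m d : int) :
  d != 0 -> ratr (m%:~R / d%:~R) = m%:~R / d%:~R :> K.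
Proof.
move=> d0; set q := _ / _; have dQ : d%:~R != 0 :> rat by rewrite intr_eq0.
apply/eqP; rewrite eqr_div ?intr_neq0_char0 ?denq_neq0 // -!rmorphM /=.
apply/eqP; congr _%:~R; apply: (@intr_inj rat).
by rewrite !rmorphM /= numqE mulrAC divfK.
Qed.

Lemma ratr_zmod_morphism_char0 : zmod_morphism (@ratr K).
Proof.
move=> x y; have [dx dy] := (denq_neq0 x, denq_neq0 y).
have ->: x - y = (numq x * denq y - numq y * denq x)%:~R
                 / (denq x * denq y)%:~R.
  rewrite -{1}[x]divq_num_den -{1}[y]divq_num_den !(rmorphB, rmorphM) /=.
  by field; rewrite !intr_eq0 dx dy.
rewrite ratr_frac_char0 ?mulf_neq0 // /ratr !(rmorphB, rmorphM) /=.
by field; rewrite !intr_neq0_char0.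
Qed.

Lemma ratr_monoid_morphism_char0 : monoid_morphism (@ratr K).
Proof.
split=> [|x y]; first by rewrite /ratr divr1.
have [dx dy] := (denq_neq0 x, denq_neq0 y).
have ->: x * y = (numq x * numq y)%:~R / (denq x * denq y)%:~R.
  rewrite -{1}[x]divq_num_den -{1}[y]divq_num_den !rmorphM /=.
  by field; rewrite !intr_eq0 dx dy.
rewrite ratr_frac_char0 ?mulf_neq0 // /ratr !rmorphM /=.
by field; rewrite !intr_neq0_char0.
Qed.

Definition ratr_char0 : {rmorphism rat -> K} :=
  HB.pack (@ratr K)
    (GRing.isZmodMorphism.Build rat K (@ratr K) ratr_zmod_morphism_char0)
    (GRing.isMonoidMorphism.Build rat K (@ratr K) ratr_monoid_morphism_char0).

End RatrCharZero.

(** * Subtraction-free expressions *)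

Inductive sf (T : Type) : Type :=
| SFone
| SFvar of T
| SFadd of sf T & sf T
| SFmul of sf T & sf T
| SFinv of sf T.
Arguments SFone {T}.

Fixpoint sfeval (T : Type) (K : fieldType) (v : T -> K) (e : sf T) : K :=
  match e with
  | SFone => 1
  | SFvar t => v t
  | SFadd e1 e2 => sfeval v e1 + sfeval v e2
  | SFmul e1 e2 => sfeval v e1 * sfeval v e2
  | SFinv e1 => (sfeval v e1)^-1
  end.

Fixpoint sfbind (T U : Type) (m : T -> sf U) (e : sf T) : sf U :=
  match e with
  | SFone => SFone
  | SFvar t => m t
  | SFadd e1 e2 => SFadd (sfbind m e1) (sfbind m e2)
  | SFmul e1 e2 => SFmul (sfbind m e1) (sfbind m e2)
  | SFinv e1 => SFinv (sfbind m e1)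
  end.

Lemma eq_sfeval (T : Type) (K : fieldType) (v w : T -> K) :
  v =1 w -> sfeval v =1 sfeval w.
Proof.
by move=> vw; elim=> [|t|e1 IH1 e2 IH2|e1 IH1 e2 IH2|e IH] //=;
  rewrite ?vw ?IH1 ?IH2 ?IH.
Qed.

Lemma sfeval_bind (T U : Type) (K : fieldType) (v : U -> K) (m : T -> sf U) e :
  sfeval v (sfbind m e) = sfeval (fun t => sfeval v (m t)) e.
Proof.
by elim: e => [|t|e1 IH1 e2 IH2|e1 IH1 e2 IH2|e IH] //=; rewrite ?IH1 ?IH2 ?IH.
Qed.

(** Inversion is total, with 0 sent to 0. Since subexpressions are expressions, this condition
    excludes zero denominators at every depth. *)
Definition sf_nonvanishing (T : Type) (K : fieldType) (v : T -> K) : Prop :=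
  forall e, sfeval v e != 0.

Definition sf_determines (T : Type) (K L : fieldType) (v : T -> K)
    (w : T -> L) : Prop :=
  forall e1 e2, sfeval v e1 = sfeval v e2 -> sfeval w e1 = sfeval w e2.

Definition sf_free (T : Type) (K : fieldType) (v : T -> K) : Prop :=
  forall a : T -> rat, (forall t, 0 < a t) -> sf_determines v a.

Lemma sfeval_gt0 (T : Type) (a : T -> rat) :
  (forall t, 0 < a t) -> forall e, 0 < sfeval a e.
Proof.
move=> a0; elim=> [|t|e1 IH1 e2 IH2|e1 IH1 e2 IH2|e IH] //=.
- exact: addr_gt0.
- exact: mulr_gt0.
- by rewrite invr_gt0.
Qed.

Lemma sf_nonvanishing_pos (T : Type) (a : T -> rat) :
  (forall t, 0 < a t) -> sf_nonvanishing a.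
Proof. by move=> a0 e; rewrite gt_eqF // sfeval_gt0. Qed.

Lemma sf_nonvanishing_bind (T U : Type) (K : fieldType) (v : U -> K)
    (m : T -> sf U) :
  sf_nonvanishing v -> sf_nonvanishing (fun t => sfeval v (m t)).
Proof. by move=> nzv e; rewrite -sfeval_bind. Qed.

(** If [e] vanishes then [e + e = e], an identity that fails at the point with all coordinates 1. *)
Lemma sf_free_nonvanishing (T : Type) (K : fieldType) (v : T -> K) :
  sf_free v -> sf_nonvanishing v.
Proof.
move=> frv e; apply/eqP => e0.
have := @frv (fun=> 1) (fun=> ltr01) (SFadd e e) e.
rewrite /= e0 addr0 => /(_ erefl) /eqP; rewrite -subr_eq0 addrK.
by rewrite (negPf (sf_nonvanishing_pos (fun=> ltr01) e)).
Qed.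

(** A positive point on [T] extends to [U] by the value 1 off the image of [g]. *)
Lemma sf_free_comp (T U : Type) (K : fieldType) (v : U -> K) (g : T -> U)
    (g' : U -> option T) :
  pcancel g g' -> sf_free v -> sf_free (v \o g).
Proof.
move=> gK frv a a0 e1 e2 e12.
pose a' u := if g' u is Some t then a t else 1.
have a'0 u : 0 < a' u by rewrite /a'; case: (g' u).
have := frv a' a'0 (sfbind (fun t => SFvar (g t)) e1)
                   (sfbind (fun t => SFvar (g t)) e2).
rewrite !sfeval_bind => /(_ e12).
by rewrite !(@eq_sfeval _ _ (fun t => sfeval a' _) a) // => t;
  rewrite /= /a' gK.
Qed.

(** * Expressions as fractions of polynomials *)

Section SubtractionFreeFractions.
Variable T : finType.
Notation poly := {mpoly rat[#|T|]}.

Fixpoint sffrac (e : sf T) : poly * poly :=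
  match e with
  | SFone => (1, 1)
  | SFvar t => ('X_(enum_rank t), 1)
  | SFadd e1 e2 =>
      let: (n1, d1) := sffrac e1 in let: (n2, d2) := sffrac e2 in
      (n1 * d2 + n2 * d1, d1 * d2)
  | SFmul e1 e2 =>
      let: (n1, d1) := sffrac e1 in let: (n2, d2) := sffrac e2 in
      (n1 * n2, d1 * d2)
  | SFinv e1 => let: (n1, d1) := sffrac e1 in (d1, n1)
  end.

Section Evaluation.
Variables (K : fieldType) (charK : [pchar K] =i pred0) (v : T -> K).

Definition poly_at (p : poly) : K := mmap (@ratr K) (fun i => v (enum_val i)) p.

Let phi : poly -> K := mmap (ratr_char0 charK) (fun i => v (enum_val i)).

Let poly_atE : poly_at = phi. Proof. by []. Qed.

Lemma poly_at1 : poly_at 1 = 1.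
Proof. by rewrite poly_atE /phi rmorph1. Qed.

Lemma poly_atX t : poly_at 'X_(enum_rank t) = v t.
Proof. by rewrite poly_atE /phi mmapX mmap1U enum_rankK. Qed.

Lemma poly_atD p q : poly_at (p + q) = poly_at p + poly_at q.
Proof. by rewrite poly_atE /phi rmorphD. Qed.

Lemma poly_atB p q : poly_at (p - q) = poly_at p - poly_at q.
Proof. by rewrite poly_atE /phi rmorphB. Qed.

Lemma poly_atM p q : poly_at (p * q) = poly_at p * poly_at q.
Proof. by rewrite poly_atE /phi rmorphM. Qed.

Lemma poly_at0 : poly_at 0 = 0.
Proof. by rewrite poly_atE /phi rmorph0. Qed.

Definition poly_at_simp :=
  (poly_at0, poly_at1, poly_atX, poly_atD, poly_atB, poly_atM).

Lemma sffrac_nonvanishing : sf_nonvanishing v -> forall e,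
  poly_at (sffrac e).1 != 0 /\ poly_at (sffrac e).2 != 0.
Proof.
move=> nzv e.
(* Carrying the value of [e] through the induction turns the nonvanishing of the numerator into that
   of [e] itself. *)
suff [d0 en] : poly_at (sffrac e).2 != 0 /\
    sfeval v e * poly_at (sffrac e).2 = poly_at (sffrac e).1.
  by split=> //; rewrite -en mulf_neq0.
elim: e => [|t|e1|e1|e] /=.
- by rewrite poly_at1 oner_neq0 mulr1.
- by rewrite poly_at1 poly_atX oner_neq0 mulr1.
- case: (sffrac e1) => n1 d1 /= [d10 en1] e2.
  case: (sffrac e2) => n2 d2 /= [d20 en2].
  by rewrite !poly_at_simp mulf_neq0 // -en1 -en2; split=> //; ring.
- case: (sffrac e1) => n1 d1 /= [d10 en1] e2.
  case: (sffrac e2) => n2 d2 /= [d20 en2].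
  by rewrite !poly_at_simp mulf_neq0 // -en1 -en2; split=> //; ring.
- case: (sffrac e) => n d /= [d0 en]; rewrite -en mulf_neq0 //.
  by rewrite mulrA mulVf // mul1r.
Qed.

Lemma sfevalE :
  (forall e, poly_at (sffrac e).1 != 0 /\ poly_at (sffrac e).2 != 0) ->
  forall e, sfeval v e = poly_at (sffrac e).1 / poly_at (sffrac e).2.
Proof.
move=> nz; elim=> [|t|e1|e1|e] /=.
- by rewrite poly_at1 divr1.
- by rewrite poly_at1 poly_atX divr1.
- move: (nz e1); case: (sffrac e1) => n1 d1 /= [n10 d10] -> e2.
  move: (nz e2); case: (sffrac e2) => n2 d2 /= [n20 d20] ->.
  by rewrite !poly_at_simp; field; rewrite d10 d20.
- move: (nz e1); case: (sffrac e1) => n1 d1 /= [n10 d10] -> e2.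
  move: (nz e2); case: (sffrac e2) => n2 d2 /= [n20 d20] ->.
  by rewrite !poly_at_simp; field; rewrite d10 d20.
- move: (nz e); case: (sffrac e) => n d /= [n0 d0] ->.
  by rewrite invf_div.
Qed.

End Evaluation.

Lemma sffrac_neq0 e : (sffrac e).1 != 0 /\ (sffrac e).2 != 0.
Proof.
have chQ := @pchar_num rat.
have [n0 d0] :=
  sffrac_nonvanishing chQ (sf_nonvanishing_pos (fun _ : T => ltr01)) e.
by split; [move: n0|move: d0]; apply: contraNneq => ->; rewrite poly_at0.
Qed.

(** Cross-multiplying turns an identity at [v] into a polynomial relation, which independence makes
    formal. It can then be evaluated at [w], where no denominator vanishes. *)
Lemma algebraically_independent_determines (K L : fieldType) (v : T -> K)
    (w : T -> L) :
  [pchar K] =i pred0 -> [pchar L] =i pred0 ->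
  algebraically_independent v -> sf_nonvanishing w -> sf_determines v w.
Proof.
move=> chK chL indv nzw e1 e2.
have nz p : p != 0 -> poly_at v p != 0.
  by move=> p0; apply: contra_neq p0 => /indv.
have nzv e : poly_at v (sffrac e).1 != 0 /\ poly_at v (sffrac e).2 != 0.
  by have [n0 d0] := sffrac_neq0 e; split; apply: nz.
have nzw' := sffrac_nonvanishing chL nzw.
rewrite (sfevalE chK nzv e1) (sfevalE chK nzv e2).
rewrite (sfevalE chL nzw' e1) (sfevalE chL nzw' e2).
have [[_ d1] [_ d2]] := (nzv e1, nzv e2).
have [[_ d1'] [_ d2']] := (nzw' e1, nzw' e2).
move/eqP; rewrite eqr_div // -!poly_atM // => /eqP e12.
have := indv ((sffrac e1).1 * (sffrac e2).2 -
              (sffrac e2).1 * (sffrac e1).2).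
rewrite -/(poly_at v _) poly_atB // e12 subrr => /(_ erefl)/eqP.
rewrite subr_eq0 => /eqP e12'.
by apply/eqP; rewrite eqr_div // -!poly_atM // e12'.
Qed.

Lemma algebraically_independent_sf_free (K : fieldType) (v : T -> K) :
  [pchar K] =i pred0 -> algebraically_independent v -> sf_free v.
Proof.
move=> chK indv a a0; apply: algebraically_independent_determines => //.
  exact: pchar_num.
exact: sf_nonvanishing_pos.
Qed.

End SubtractionFreeFractions.

(** * Seed mutation *)

Definition pos_part (k : int) : nat := if 0 < k then `|k|%N else 0%N.

(** Natural exponents make this meaningful in any commutative ring, in particular inside the cluster
    algebra, where ring morphisms can be applied to it. *)
Definition exchange_binomial (T : finType) (R : comNzRingType) (v : T -> R)
    (b : T -> int) : R :=
  \prod_t v t ^+ pos_part (b t) + \prod_t v t ^+ pos_part (- b t).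

Lemma rmorph_exchange_binomial (T : finType) (R R' : comNzRingType)
    (f : {rmorphism R -> R'}) (v : T -> R) (b : T -> int) :
  f (exchange_binomial v b) = exchange_binomial (f \o v) b.
Proof.
rewrite rmorphD !rmorph_prod.
by congr (_ + _); apply: eq_bigr => t _; rewrite rmorphXn.
Qed.

(** The label [t] occurs in at most one of the two monomials, with exponent the absolute value of
    [b t]; the other monomial is 1. *)
Lemma exchange_binomial_at2 (T : finType) (t : T) (b : T -> int) :
  exchange_binomial (fun u => if u == t then 2 else 1 : rat) b =
    2 ^+ `|b t|%N + 1.
Proof.
have mon (c : T -> int) :
    \prod_u (if u == t then 2 else 1 : rat) ^+ pos_part (c u) =
    2 ^+ pos_part (c t).
  rewrite (bigD1 t) //= eqxx big1 ?mulr1 // => u /negPf->.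
  exact: expr1n.
rewrite /exchange_binomial mon (mon (fun u => - b u)) /pos_part oppr_gt0.
by case: ltgtP => [_|_|<-]; rewrite ?abszN ?expr0 // addrC.
Qed.

Definition sf_binomial (T : finType) (U : Type) (g : T -> U) (b : T -> int) :
    sf U :=
  let mon (c : T -> int) :=
    \big[@SFmul _/SFone]_t iter (pos_part (c t)) (SFmul (SFvar (g t))) SFone in
  SFadd (mon b) (mon (fun t => - b t)).

Lemma sfeval_binomial (T : finType) (U : Type) (K : fieldType) (v : U -> K)
    (g : T -> U) (b : T -> int) :
  sfeval v (sf_binomial g b) = exchange_binomial (v \o g) b.
Proof.
have mon (c : T -> int) : sfeval v (\big[@SFmul _/SFone]_t
    iter (pos_part (c t)) (SFmul (SFvar (g t))) SFone) =
    \prod_t v (g t) ^+ pos_part (c t).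
  rewrite (big_morph (sfeval v) (id1 := 1) (op1 := *%R)) //.
  apply: eq_bigr => t _; elim: (pos_part _) => //= k ->.
  by rewrite exprS.
by rewrite /= !mon.
Qed.

Section Mutation.
Variables (E F : finType).
Implicit Types (b : E -> E + F -> int) (x : E) (s : seq E).

Lemma new_varE (K : fieldType) (S : seed K E F) x :
  new_var S x = (var S (inl x))^-1 * exchange_binomial (var S) (bmat S x).
Proof.
have part (c : E + F -> int) : \prod_(t | 0 < c t) var S t ^ c t =
    \prod_t var S t ^+ pos_part (c t).
  rewrite [LHS]big_mkcond; apply: eq_bigr => t _; rewrite /pos_part.
  by case: ifP => // c0; rewrite -[in LHS](gtz0_abs c0) -exprnP.
rewrite /new_var /exchange_binomial part -(part (fun t => - bmat S x t)).
by congr (_ * (_ + _)); apply: eq_bigl => t; rewrite oppr_gt0.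
Qed.

Lemma exchange_relation (K : fieldType) (S : seed K E F) x :
  var S (inl x) != 0 ->
  var S (inl x) * var (mutate S x) (inl x) =
    exchange_binomial (var S) (bmat S x).
Proof. by move=> x0; rewrite /= eqxx new_varE mulVKf. Qed.

Definition mx_mutations b s : E -> E + F -> int :=
  foldl (fun c x => mx_mutate inl x c) b s.

Lemma bmat_mutations (K : fieldType) (S : seed K E F) s :
  bmat (mutations S s) = mx_mutations (bmat S) s.
Proof. by elim: s S => //= x s IH S; rewrite IH. Qed.

(** This keeps the mutated variable out of its own exchange binomial, along all mutation
    sequences. *)
Definition null_diagonal b : Prop :=
  forall s x, mx_mutations b s x (inl x) = 0.

Lemma exchange_matrix_mutations (K : fieldType) (S : seed K E F) s :
  exchange_matrix (mutations S s) =
    foldl (fun c x => mx_mutate id x c) (exchange_matrix S) s.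
Proof. by elim: s S => //= x s IH S; rewrite IH. Qed.

Lemma seed_null_diagonal (K : fieldType) (S : seed K E F) :
  is_seed S -> null_diagonal (bmat S).
Proof.
move=> [_ _ skewS] s x; have := skewS s x x.
rewrite -exchange_matrix_mutations /exchange_matrix bmat_mutations.
by case=> [[]//|]; rewrite ltNge -expr2 sqr_ge0.
Qed.

Definition sf_new (b : E -> E + F -> int) x : sf (E + F) :=
  SFmul (SFinv (SFvar (inl x))) (sf_binomial id (b x)).

Definition sf_mutate b x (t : E + F) : sf (E + F) :=
  if t == inl x then sf_new b x else SFvar t.

Lemma sfeval_mutate (K : fieldType) (S : seed K E F) x t :
  sfeval (var S) (sf_mutate (bmat S) x t) = var (mutate S x) t.
Proof.
rewrite /sf_mutate /=; case: eqP => // _.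
by rewrite new_varE -[exchange_binomial _ _](sfeval_binomial (var S) id).
Qed.

(** The expression depends on the matrix alone, so it can be evaluated at specialised variables as
    well. *)
Fixpoint sf_mutations b s (t : E + F) : sf (E + F) :=
  if s is x :: s' then
    sfbind (sf_mutate b x) (sf_mutations (mx_mutate inl x b) s' t)
  else SFvar t.

Lemma sfeval_mutations (K : fieldType) (S : seed K E F) s t :
  sfeval (var S) (sf_mutations (bmat S) s t) = var (mutations S s) t.
Proof.
elim: s S => //= x s IH S; rewrite sfeval_bind -IH.
by apply: eq_sfeval => t'; rewrite sfeval_mutate.
Qed.

(* Each mutation maps the positive rational points onto themselves, because   *)
(* the exchange binomial does not involve the mutated variable.               *)
Lemma sf_free_mutate (K : fieldType) (S : seed K E F) x :
  bmat S x (inl x) = 0 -> sf_free (var S) -> sf_free (var (mutate S x)).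
Proof.
move=> bxx frS c c0 e1 e2 e12.
pose a t := if t == inl x
  then (c (inl x))^-1 * exchange_binomial c (bmat S x) else c t.
have a0 t : 0 < a t.
  rewrite /a; case: ifP => // _; rewrite mulr_gt0 ?invr_gt0 //.
  by rewrite addr_gt0 // prodr_gt0 // => u _; rewrite exprn_gt0.
have binE : exchange_binomial a (bmat S x) = exchange_binomial c (bmat S x).
  by congr (_ + _); apply: eq_bigr => t _; rewrite /a; case: eqP => // ->;
    rewrite bxx ?oppr0 !expr0.
have mut t : sfeval a (sf_mutate (bmat S) x t) = c t.
  (* The rational point [a] is viewed as the variables of a seed over [rat], so that [sfeval_mutate]
     applies to it. *)
  rewrite -[a]/(var (Seed a (bmat S))) -[bmat S]/(bmat (Seed a (bmat S))).
  rewrite sfeval_mutate /=; case: (eqVneq t) => [->|tx].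
    rewrite new_varE /= binE /a eqxx invfM invrK mulrAC mulfK //.
    rewrite gt_eqF // addr_gt0 // prodr_gt0 // => u _; exact: exprn_gt0.
  by rewrite /a (negPf tx).
have := frS a a0 (sfbind (sf_mutate (bmat S) x) e1)
                 (sfbind (sf_mutate (bmat S) x) e2).
rewrite !sfeval_bind !(eq_sfeval mut) !(eq_sfeval (sfeval_mutate S x)).
exact.
Qed.

Lemma sf_free_mutations (K : fieldType) (S : seed K E F) s :
  null_diagonal (bmat S) -> sf_free (var S) -> sf_free (var (mutations S s)).
Proof.
elim: s S => //= x s IH S d0 frS; apply: IH => [s' y|].
  exact: (d0 (x :: s')).
by apply: sf_free_mutate => //; exact: (d0 [::]).
Qed.

End Mutation.

(** Two variables are separated by the point that is 2 at one of them and 1 elsewhere. *)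
Lemma sf_free_inj (T : finType) (K : fieldType) (v : T -> K) :
  sf_free v -> injective v.
Proof.
move=> frv t u tu; apply/eqP; apply: contraPT tu => tu.
pose a w : rat := if w == t then 2 else 1.
have a0 w : 0 < a w by rewrite /a; case: ifP.
move/(frv a a0 (SFvar t) (SFvar u)).
by rewrite /= /a eqxx eq_sym (negPf tu).
Qed.

Lemma sf_free_not_int (T : finType) (K : fieldType) (v : T -> K) t (k : int) :
  sf_free v -> v t != k%:~R.
Proof.
(* [nat n] stands for [n + 1], as no expression denotes 0. A positive integer value is refuted at a
   larger constant point, zero and negative ones by nonvanishing. *)
move=> frv; pose nat n := iter n (SFadd SFone) SFone : sf T.
have natE (L : fieldType) (w : T -> L) n : sfeval w (nat n) = n.+1%:R.
  by elim: n => //= n ->; rewrite [RHS]mulrS.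
have nz := sf_free_nonvanishing frv.
case: k => [[|n]|n].
- exact: (nz (SFvar t)).
- apply/eqP => tn.
  have := @frv (fun=> n.+2%:R) (fun=> ltr0Sn _ _) (SFvar t) (nat n).
  rewrite !natE /= => /(_ tn)/eqP.
  by rewrite eqr_nat eqn_leq ltnn.
- apply/eqP => tn; have := nz (SFadd (SFvar t) (nat n)).
  by rewrite /= natE tn NegzE mulrNz addNr eqxx.
Qed.

(** [B] lies in the image of [A] under the partial function with graph [r], made total by an
    arbitrary default value. *)
Lemma finite_set_rel (T U : choiceType) (A : set T) (B : set U)
    (r : T -> U -> Prop) :
  finite_set A -> (forall u, B u -> exists2 t, A t & r t u) ->
  (forall t u u', r t u -> r t u' -> u = u') -> finite_set B.
Proof.
move=> finA rAB rfun.
have [[u0 Bu0]|nB] := pselect (exists u0, B u0); last first.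
  by rewrite (_ : B = set0) // -subset0 => u Bu; case: nB; exists u.
apply: sub_finite_set; last first.
  exact: (finite_image (fun t => xget u0 (r t)) finA).
move=> u Bu; have [t At rtu] := rAB u Bu; exists t => //.
by apply: xget_unique => // u' rtu'; apply: rfun rtu' rtu.
Qed.

(** * Sub-seeds *)

Section SubSeed.
Variables (K : fieldType) (E F : finType) (S : seed K E F).
Variables (I0 : {set E}) (I1 : {set E + F}).
Notation T := (sub_seed S I0 I1).
Notation label := (@sub_label E F I0 I1).

Definition sub_unlabel (t : E + F) : option (sub_ex I0 I1 + sub_fr I0 I1) :=
  if t is inl x then
    if insub x is Some i then Some (inl i) else omap inr (insub t)
  else omap inr (insub t).

Lemma sub_labelK : pcancel label sub_unlabel.
Proof.
case=> [i|[[x|j] jP]] /=.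
- by rewrite valK.
- case: insubP => [i /andP[xI0 _] _|_]; last by rewrite insubT.
  by case/andP: (jP); rewrite (negPf xI0).
- by rewrite insubT.
Qed.

Lemma sub_unlabelP t : t \notin I1 -> exists u, t = label u.
Proof.
case: t => [x|j] tI1; last by exists (inr (Sub (inr j) tI1)).
have [xI0|xI0] := boolP (x \in I0).
  have xP : (x \in I0) && (inl x \notin I1) by rewrite xI0.
  by exists (inr (Sub (inl x : E + F) xP)).
have xP : (x \notin I0) && (inl x \notin I1) by rewrite xI0.
by exists (inl (Sub x xP)).
Qed.

Lemma sub_label_notin u : label u \notin I1.
Proof. by case: u => [[x /= /andP[]]|[t /= /andP[]]]. Qed.

Lemma sub_label_eq u i : (label u == inl (val i)) = (u == inl i).
Proof. exact: (inj_eq (pcan_inj sub_labelK) u (inl i)). Qed.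

(** The invariant kept by simultaneous mutation: [R] retains all labels of [S], but its deleted
    variables equal 1. *)
Definition restricts (T' : seed K (sub_ex I0 I1) (sub_fr I0 I1))
    (R : seed K E F) : Prop :=
  [/\ forall t, t \in I1 -> var R t = 1,
      forall u, var T' u = var R (label u)
    & forall i u, bmat T' i u = bmat R (val i) (label u)].

(** Variables equal to 1 contribute nothing to exchange monomials, and the direction [val i] lies
    outside [I1], so they are never mutated. *)
Lemma restricts_mutate T' R i :
  restricts T' R -> restricts (mutate T' i) (mutate R (val i)).
Proof.
move=> [R1 varT bT].
have mon (c : E + F -> int) : \prod_t var R t ^+ pos_part (c t) =
    \prod_u var T' u ^+ pos_part (c (label u)).
  rewrite (bigID (mem I1)) /= big1 ?mul1r => [|t tI]; last first.
    by rewrite R1 // expr1n.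
  rewrite (reindex_omap label sub_unlabel) => [|t /sub_unlabelP[u ->]].
    apply: eq_big => [u|u _]; last by rewrite varT.
    by rewrite sub_label_notin sub_labelK eqxx.
  by rewrite sub_labelK.
have binT : exchange_binomial (var R) (bmat R (val i)) =
    exchange_binomial (var T') (bmat T' i).
  rewrite /exchange_binomial mon (mon (fun t => - bmat R (val i) t)).
  by congr (_ + _); apply: eq_bigr => u _; rewrite bT.
split=> [t tI|u|j u] /=.
- case: eqP => [ti|_]; last exact: R1.
  by case/andP: (valP i); rewrite -ti tI.
- by rewrite sub_label_eq !new_varE binT varT; case: eqP.
- by rewrite /mx_mutate -val_eqE /= sub_label_eq !bT.
Qed.

Lemma restricts_mutations T' R s :
  restricts T' R -> restricts (mutations T' s) (mutations R (map val s)).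
Proof. by elim: s T' R => //= i s IH T' R /(restricts_mutate i); apply: IH. Qed.

Definition delete_seed : seed K E F :=
  Seed (fun t => if t \in I1 then 1 else var S t) (bmat S).

Lemma restricts_delete : restricts T delete_seed.
Proof.
split=> [t /= ->//|u /=|//].
by rewrite (negPf (sub_label_notin u)).
Qed.

Lemma exchange_matrix_sub_seed s i j :
  exchange_matrix (mutations T s) i j =
  exchange_matrix (mutations S (map val s)) (val i) (val j).
Proof.
have [_ _ bT] := restricts_mutations s restricts_delete.
by rewrite /exchange_matrix bT !bmat_mutations.
Qed.

Lemma null_diagonal_sub_seed :
  null_diagonal (bmat S) -> null_diagonal (bmat T).
Proof.
move=> d0 s i; rewrite -bmat_mutations -/(exchange_matrix _ i i).
by rewrite exchange_matrix_sub_seed /exchange_matrix bmat_mutations.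
Qed.

Lemma sf_free_sub_seed : sf_free (var S) -> sf_free (var T).
Proof. exact: sf_free_comp sub_labelK. Qed.

(** Setting a variable to 1 substitutes the expression [SFone] for it. *)
Lemma sf_nonvanishing_delete :
  sf_nonvanishing (var S) -> sf_nonvanishing (var delete_seed).
Proof.
move=> nzS e.
have := sf_nonvanishing_bind
  (fun t => if t \in I1 then SFone else SFvar t) nzS e.
by rewrite (@eq_sfeval _ _ _ (var delete_seed)) // => t /=; case: ifP.
Qed.

(** A cluster variable of the sub-seed is the value at [delete_seed] of the expression giving the
    variable of [S] reached by the same mutations. The value at [var S] determines the value at
    [delete_seed], so specialisation is a function on cluster variables. *)
Lemma finite_type_sub_seed : is_seed S -> finite_type S -> finite_type T.
Proof.
move=> seedS finS; have [chK indS _] := seedS.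
have freeS := algebraically_independent_sf_free chK indS.
have detS : sf_determines (var S) (var delete_seed).
  apply: algebraically_independent_determines => //.
  exact/sf_nonvanishing_delete/sf_free_nonvanishing.
apply: (finite_set_rel
  (r := fun z z' => exists2 e, z = sfeval (var S) e
                             & z' = sfeval (var delete_seed) e) finS).
- move=> _ [s [i ->]].
  exists (var (mutations S (map val s)) (inl (val i))).
    by exists (map val s), (val i).
  exists (sf_mutations (bmat S) (map val s) (inl (val i))).
    by rewrite sfeval_mutations.
  have [_ varT _] := restricts_mutations s restricts_delete.
  by rewrite varT -sfeval_mutations.
- by move=> z z' z'' [e -> ->] [e' /detS ee' ->].
Qed.

End SubSeed.

(** * Finite mutation type as boundedness of matrix entries *)

Section BoundedExchangeMatrices.
Variables (K : fieldType) (E F : finType) (S : seed K E F).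

Definition bounded_exchange_matrices : Prop :=
  exists N : nat, forall s x y, `|exchange_matrix (mutations S s) x y| <= N%:Z.

(** Permuting labels only moves entries around, so finitely many classes have a common bound.
    Conversely, there are finitely many integer matrices of given size with bounded entries. *)
Lemma finite_mutation_type_bounded :
  finite_mutation_type S <-> bounded_exchange_matrices.
Proof.
split=> [finS|[N bndN]].
- have [cs csE] := (finite_seqP _).1 finS.
  have bndc (C : set (E -> E -> int)) : exists N : nat,
      (exists b, C = perm_class b) ->
      forall c, C c -> forall x y, `|c x y| <= N%:Z.
    have [[b ->]|nC] := pselect (exists b, C = perm_class b); last first.
      by exists 0%N.
    exists (\max_x \max_y `|b x y|%N) => _ _ [p ->] x y.
    rewrite -abszE lez_nat (leq_trans _ (leq_bigmax (p x))) //.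
    exact: (leq_bigmax (F := fun y => `|b (p x) y|%N) (p y)).
  have [N bndN] : exists N : nat, forall C, C \in cs ->
      (exists b, C = perm_class b) ->
      forall c, C c -> forall x y, `|c x y| <= N%:Z.
    elim: cs {csE} => [|C cs [N IH]]; first by exists 0%N.
    have [M bndM] := bndc C; exists (maxn M N) => D.
    rewrite in_cons => /predU1P[->|Dcs] perm c Cc x y.
      by rewrite (le_trans (bndM _ _ Cc x y)) // lez_nat leq_maxl.
    by rewrite (le_trans (IH _ Dcs perm c Cc x y)) // lez_nat leq_maxr.
  exists N => s x y; set b := exchange_matrix _.
  apply: (bndN (perm_class b)); last 1 first.
  + by exists 1%g; apply/funext => x'; apply/funext => y'; rewrite !perm1.
  + have : [set` cs]%classic (perm_class b) by rewrite -csE; exists s.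
    by [].
  + by exists b.
(* Entries between [- N] and [N] are shifted by [N] into the range from 0 to [2 N]. *)
- pose dec (h : {ffun E * E -> 'I_(N + N).+1}) :=
    perm_class (fun x y => (h (x, y))%:Z - N%:Z).
  apply: sub_finite_set; last first.
    exact: (finite_image dec (finite_finset (X := setT))).
  move=> _ [s _ <-]; set b := exchange_matrix _.
  exists [ffun xy => inord (absz (b xy.1 xy.2 + N%:Z)%R)] => //.
  congr perm_class; apply/funext => x; apply/funext => y.
  have := bndN s x y; rewrite -/b ler_norml => /andP[bl bu].
  have b0 : 0 <= b x y + N%:Z by rewrite -lerBlDr sub0r.
  rewrite ffunE /= inordK ?gez0_abs ?addrK //.
  by rewrite ltnS -lez_nat gez0_abs // PoszD lerD2r.
Qed.

End BoundedExchangeMatrices.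

Lemma bounded_exchange_matrices_sub_seed (K : fieldType) (E F : finType)
    (S : seed K E F) (I0 : {set E}) (I1 : {set E + F}) :
  bounded_exchange_matrices S -> bounded_exchange_matrices (sub_seed S I0 I1).
Proof.
by move=> [N bN]; exists N => s x y; rewrite exchange_matrix_sub_seed.
Qed.

(** * Rooted cluster morphisms *)

Section MutationSequences.
Variables (K : fieldType) (E F : finType).
Implicit Types (S : seed K E F) (ys : seq K) (s : seq E).

Lemma admissible_rcons S ys y :
  admissible S ys -> exchangeable (foldl (@seed_mut K E F) S ys) y ->
  admissible S (rcons ys y).
Proof. by elim: ys S => //= z ys IH S [zS ysS] yS; split=> //; apply: IH. Qed.

Lemma elt_muts_rcons S ys y z :
  elt_muts S (rcons ys y) z =
    elt_mut (foldl (@seed_mut K E F) S ys) y (elt_muts S ys z).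
Proof. by elim: ys S z => /=. Qed.

Lemma pick_var S x :
  injective (var S) -> [pick x' | var S (inl x') == var S (inl x)] = Some x.
Proof.
move=> injS; case: pickP => [x' /eqP/injS[->]//|/(_ x)].
by rewrite eqxx.
Qed.

(** Morphisms are stated with sequences of ring elements, seeds are mutated along labels; this says
    that [ys] realises [s]. *)
Definition follows S ys s : Prop :=
  [/\ admissible S ys, foldl (@seed_mut K E F) S ys = mutations S s
    & forall t, elt_muts S ys (var S t) = var (mutations S s) t].

Lemma follows_rcons S ys s x :
  injective (var (mutations S s)) -> follows S ys s ->
  follows S (rcons ys (var (mutations S s) (inl x))) (rcons s x).
Proof.
move=> injS [adm seedE eltE]; split; last move=> t.
- by apply: admissible_rcons => //; rewrite seedE; exists x.
- by rewrite /mutations !foldl_rcons seedE /seed_mut pick_var.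
- rewrite elt_muts_rcons seedE eltE /elt_mut pick_var // (inj_eq injS).
  by rewrite /mutations foldl_rcons.
Qed.

End MutationSequences.

Section RootedClusterEmbedding.
Variables (K K' : fieldType) (E F E' F' : finType).
Variables (S' : seed K' E' F') (T : seed K E F).
Variable f : {rmorphism rca S' -> rca T}.
Hypotheses (f_inj : injective f) (f_rcm : rooted_cluster_morphism f).
Hypotheses (freeS' : sf_free (var S')) (freeT : sf_free (var T)).
Hypotheses (nullS' : null_diagonal (bmat S')) (nullT : null_diagonal (bmat T)).

(** Since [f] fixes integers and is injective, the variable itself would be an integer. *)
Lemma rca_var_not_int t (k : int) : f (rca_var S' t) <> k%:~R.
Proof.
rewrite -(rmorph_int f) => /f_inj /(congr1 val); rewrite rmorph_int.
exact/eqP/sf_free_not_int.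
Qed.

Lemma rca_label : exists (sg : E' -> E) (g : E' + F' -> E + F),
  (forall x, g (inl x) = inl (sg x)) /\
  (forall t, f (rca_var S' t) = rca_var T (g t)).
Proof.
have [varf exf _] := f_rcm.
have /choice[sg sgE] x : exists x', f (rca_var S' (inl x)) = rca_var T (inl x').
  by case: (exf x) => // -[k /rca_var_not_int].
have /choice[h hE] t : exists t', f (rca_var S' t) = rca_var T t'.
  by case: (varf t) => // -[k /rca_var_not_int].
exists sg, (fun t => if t is inl x then inl (sg x) else h t).
by split=> // -[x|j].
Qed.

Lemma mutated_var_inj s : injective (var (mutations S' s)).
Proof. exact/sf_free_inj/sf_free_mutations. Qed.

Lemma mutated_var_injT s : injective (var (mutations T s)).
Proof. exact/sf_free_inj/sf_free_mutations. Qed.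

Variables (sg : E' -> E) (g : E' + F' -> E + F).
Hypothesis g_inl : forall x, g (inl x) = inl (sg x).
Hypothesis f_var : forall t, f (rca_var S' t) = rca_var T (g t).

Lemma rca_label_inj : injective g.
Proof.
move=> t u tu; apply: (mutated_var_inj (s := [::])) => /=.
have /f_inj/(congr1 val) // : f (rca_var S' t) = f (rca_var S' u).
by rewrite !f_var tu.
Qed.

(** By induction on [s] from the right, one sequence of elements [ys] realises [s] in [S'] while its
    image realises [map sg s] in [T]. Distinctness of the variables in each seed makes the mutated
    direction unambiguous, and the morphism condition matches the new variables. *)
Lemma rooted_cluster_mutations s : exists w : E' + F' -> rca S',
  (forall t, val (w t) = var (mutations S' s) t) /\
  (forall t, val (f (w t)) = var (mutations T (map sg s)) (g t)).
Proof.
suff [ys [foS' foT wE]] : exists ys : seq (rca S'),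
    [/\ follows S' [seq val y | y <- ys] s,
        follows T [seq val (f y) | y <- ys] (map sg s)
      & forall t, val (f (rca_muts S' [seq val y | y <- ys] t)) =
                  var (mutations T (map sg s)) (g t)].
  exists (rca_muts S' [seq val y | y <- ys]); split=> // t.
  by have [_ _ <-] := foS'.
have [_ _ mutf] := f_rcm.
have wE ys s' : follows S' [seq val y | y <- ys] s' ->
    follows T [seq val (f y) | y <- ys] (map sg s') ->
    forall t, val (f (rca_muts S' [seq val y | y <- ys] t)) =
              var (mutations T (map sg s')) (g t).
  by move=> [adm _ _] [admT _ eltT] t; rewrite mutf // f_var eltT.
elim/last_ind: s => [|s x [ys [foS' foT _]]].
  by exists [::]; split=> // t; rewrite -[RHS]/(val (rca_var T (g t))) -f_var.
pose y := rca_muts S' [seq val y | y <- ys] (inl x).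
have yE : val y = var (mutations S' s) (inl x) by case: foS' => _ _ <-.
have fyE : val (f y) = var (mutations T (map sg s)) (inl (sg x)).
  by rewrite (wE _ s) // g_inl.
have foS'y : follows S' [seq val y | y <- rcons ys y] (rcons s x).
  by rewrite map_rcons yE; apply/follows_rcons/foS'/mutated_var_inj.
have foTy : follows T [seq val (f y) | y <- rcons ys y] (map sg (rcons s x)).
  by rewrite !map_rcons fyE; apply/follows_rcons/foT/mutated_var_injT.
by exists (rcons ys y); split=> //; apply: wE.
Qed.

(** Cluster variables of [S'] are recovered from their images, as [f] is injective. *)
Lemma finite_type_rooted_cluster : finite_type T -> finite_type S'.
Proof.
move=> finT; apply: (finite_set_rel
  (r := fun z z' => exists y : rca S', z = val (f y) /\ z' = val y) finT).
- move=> _ [s [x ->]]; have [w [wE fwE]] := rooted_cluster_mutations s.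
  exists (val (f (w (inl x)))); last by exists (w (inl x)); rewrite wE.
  by rewrite fwE g_inl; exists (map sg s), (sg x).
- by move=> z z' z'' [y [-> ->]] [y' [/val_inj/f_inj -> ->]].
Qed.

Lemma abs_exchange_matrix_rooted_cluster s x y :
  `|exchange_matrix (mutations S' s) x y| =
  `|exchange_matrix (mutations T (map sg s)) (sg x) (sg y)|.
Proof.
have [w [wE fwE]] := rooted_cluster_mutations s.
have [w' [wE' fwE']] := rooted_cluster_mutations (rcons s x).
set S's := mutations S' s; set Ts := mutations T (map sg s).
have frS's : sf_free (var S's) by apply: sf_free_mutations.
have frTs : sf_free (var Ts) by apply: sf_free_mutations.
(* The exchange relation is lifted to the ring [rca S'], without inverses, so that [f] can be
   applied to it. *)
have relS' : w (inl x) * w' (inl x) = exchange_binomial w (bmat S's x).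
  apply: val_inj; rewrite rmorphM /= wE wE' /mutations foldl_rcons.
  rewrite exchange_relation; last exact: (sf_free_nonvanishing frS's (SFvar _)).
  rewrite [RHS](rmorph_exchange_binomial (val : {rmorphism rca S' -> K'})).
  by congr (_ + _); apply: eq_bigr => t _; rewrite /= wE.
(* The image of that relation and the exchange relation of [Ts] in direction [sg x] have the same
   left-hand product. *)
have : exchange_binomial (var Ts \o g) (bmat S's x) =
       exchange_binomial (var Ts) (bmat Ts (sg x)).
  rewrite -exchange_relation; last exact: (sf_free_nonvanishing frTs (SFvar _)).
  move/(congr1 (val \o f)): relS'.
  rewrite /= !rmorphM /= fwE fwE' g_inl map_rcons /mutations foldl_rcons => ->.
  rewrite (rmorph_exchange_binomial f).
  rewrite [RHS](rmorph_exchange_binomial (val : {rmorphism rca T -> K})).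
  by congr (_ + _); apply: eq_bigr => t _; rewrite /= fwE.
rewrite -(sfeval_binomial (var Ts) g) -(sfeval_binomial (var Ts) id).
(* This point isolates one entry: as [g] is injective, its pullback is 2 exactly at [inl y], and
   each binomial becomes a power of 2 plus 1. *)
pose a (u : E + F) : rat := if u == inl (sg y) then 2 else 1.
have a0 u : 0 < a u by rewrite /a; case: ifP.
move/(frTs a a0); rewrite !sfeval_binomial.
have ->: exchange_binomial (a \o g) (bmat S's x) =
    exchange_binomial (fun u => if u == inl y then 2 else 1) (bmat S's x).
  by congr (_ + _); apply: eq_bigr => t _;
    rewrite /= /a -g_inl (inj_eq rca_label_inj).
rewrite [RHS]exchange_binomial_at2 exchange_binomial_at2.
by move/addIr/ieexprIn => eqb; rewrite -!abszE /exchange_matrix eqb.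
Qed.

Lemma bounded_exchange_matrices_rooted_cluster :
  bounded_exchange_matrices T -> bounded_exchange_matrices S'.
Proof.
by move=> [N bN]; exists N => s x y; rewrite abs_exchange_matrix_rooted_cluster.
Qed.

End RootedClusterEmbedding.

Theorem corollary6p8 (K K' : fieldType) (E F E' F' : finType)
    (S : seed K E F) (S' : seed K' E' F')
    (hS : is_seed S) (hS' : is_seed S') (hsub : mixing_sub_rca S' S) :
  (finite_type S -> finite_type S') /\
  (finite_mutation_type S -> finite_mutation_type S').
Proof.
have [I0 [I1 [_ [f [f_rcm /bij_inj f_inj]]]]] := hsub.
have [[chK indS _] [chK' indS' _]] := (hS, hS').
have freeS' := algebraically_independent_sf_free chK' indS'.
have freeT := sf_free_sub_seed (algebraically_independent_sf_free chK indS)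
  (I0 := I0) (I1 := I1).
have nullS' := seed_null_diagonal hS'.
have nullT := null_diagonal_sub_seed (seed_null_diagonal hS)
  (I0 := I0) (I1 := I1).
have [sg [g [g_inl f_var]]] := rca_label f_inj f_rcm freeS'.
split=> [finS|/finite_mutation_type_bounded bndS].
  apply: (finite_type_rooted_cluster f_inj f_rcm freeS' freeT nullS' nullT
    g_inl f_var).
  exact: finite_type_sub_seed.
apply/finite_mutation_type_bounded.
apply: (bounded_exchange_matrices_rooted_cluster f_inj f_rcm freeS' freeT
  nullS' nullT g_inl f_var).
exact: bounded_exchange_matrices_sub_seed.
Qed.
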